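(* For all integers $n\ge \ell\ge 0$, $$\frac{1}{n+1}\binom{2n+2}{n-\ell}C_n=\sum_{k=0}^{n-\ell}\frac{(2k+1)(2k+\ell+2)(2k+2\ell+3)}{(2n+1)(2n+2)(2n+3)^2}\binom{2n+3}{n-k-\ell}\binom{2n+3}{n-k+1},$$ $$\frac{1}{n+1}\binom{2n+2}{n-\ell}C_{n+1}=\sum_{k=0}^{n-\ell}\frac{(2k+2)(2k+\ell+3)(2k+2\ell+4)}{(2n+2)(2n+3)(2n+4)^2}\binom{2n+4}{n-k-\ell}\binom{2n+4}{n-k+1},$$ $$\frac{1}{n+1}\binom{2n+2}{n-\ell}\binom{2n+1}{n}=\sum_{k=0}^{n-\ell}\frac{2k+\ell+2}{(2n+2)(2n+3)}\binom{2n+3}{n-k-\ell}\binom{2n+3}{n-k+1}.$$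
   Context: $C_n=\frac{1}{n+1}\binom{2n}{n}$ is the $n$-th Catalan number. *)

(* Defs.v *)
From mathcomp Require Import all_boot all_order all_algebra.

Set Implicit Arguments.
Unset Strict Implicit.
Unset Printing Implicit Defensive.

Import GRing.Theory.
Local Open Scope ring_scope.

Definition catalan (n : nat) : rat := (n + 1)%N%:R^-1 * 'C(2 * n, n)%:R.

(* Main.v *)
Require Import Defs.
From mathcomp Require Import all_boot all_order all_algebra.
From mathcomp Require Import zify ring lra.
Import GRing.Theory.
Local Open Scope ring_scope.

(** All three sums telescope.  Put [i = n - k - l], [j = n - k + 1] and
    [M + 1 = 2n + 3] (first and third identity) or [2n + 4] (second one).  The
    linear factors of the summands are [M + 1 - 2j], [M + 1 - i - j] and
    [M + 1 - 2i], and the summand is, up to a constant, the increment along the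
    diagonal [(i - 1, j - 1) -> (i, j)] of ['C(M, i) * 'C(M, j) * p(i, j)], where
    [p = 1] for the third identity and [p = (M - 2i)(M - 2j) + M] for the other
    two.  At [k = 0], [M - 2j] is [0] in the first identity and [1] in the second
    one. *)

(** Since [a <= b], the diagonal descending from [(a, b)] meets the boundary at first coordinate
    [0], where the last summand is itself the value of [G]; nothing is left over. *)
Lemma sum_diag_telescope (V : zmodType) (t G : nat -> nat -> V) :
  (forall j, t 0%N j = G 0%N j) ->
  (forall i j, t i.+1 j.+1 = G i.+1 j.+1 - G i j) ->
  forall a b, (a <= b)%N ->
  \sum_(0 <= k < a.+1) t (a - k)%N (b - k)%N = G a b.
Proof.
move=> t0 tS; elim=> [|a IHa] [|b] // hab; rewrite ?big_nat1 ?t0 //.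
by rewrite big_nat_recl //= tS IHa // subrK.
Qed.

Section Telescoping.

Variable F : numFieldType.

(** Subtraction is in [F]: for [i > M + 1] the factor is negative, but both binomials vanish. *)
Lemma natr_bin_down (M i : nat) :
  'C(M, i)%:R = (M.+1%:R - i%:R) / M.+1%:R * 'C(M.+1, i)%:R :> F.
Proof.
have M0 : M.+1%:R != 0 :> F by rewrite Num.Theory.pnatr_eq0.
have [le_iM|lt_Mi] := leqP i M.+1; last by rewrite !bin_small ?mulr0 // ltnW.
by rewrite -natrB // mulrAC -natrM -mul_bin_down natrM /= mulrAC divff // mul1r.
Qed.

Lemma natr_bin_diag (M i : nat) :
  'C(M, i)%:R = i.+1%:R / M.+1%:R * 'C(M.+1, i.+1)%:R :> F.
Proof.
have M0 : M.+1%:R != 0 :> F by rewrite Num.Theory.pnatr_eq0.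
rewrite mulrAC -natrM -mul_bin_diag natrM.
by rewrite [M.+1%:R * _]mulrC mulfK.
Qed.

(** With [N = M + 1], lifting all binomials to row [N] leaves
    [(N - i)(N - j) - ij = N(N - i - j)]. *)
Lemma sum_bin_linear (M a b : nat) : (a <= b)%N ->
  \sum_(0 <= k < a.+1)
     (M.+1%:R - (a - k)%:R - (b - k)%:R)
       * 'C(M.+1, a - k)%:R * 'C(M.+1, b - k)%:R
  = M.+1%:R * 'C(M, a)%:R * 'C(M, b)%:R :> F.
Proof.
have M0 : 1 + M%:R != 0 :> F by rewrite -mulrS Num.Theory.pnatr_eq0.
pose t i j : F := (M.+1%:R - i%:R - j%:R) * 'C(M.+1, i)%:R * 'C(M.+1, j)%:R.
pose G i j : F := M.+1%:R * 'C(M, i)%:R * 'C(M, j)%:R.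
apply: (@sum_diag_telescope _ t G) => [j|i j]; rewrite /t /G.
  by rewrite !bin0 (natr_bin_down M j); field.
rewrite (natr_bin_down M i.+1) (natr_bin_down M j.+1).
by rewrite (natr_bin_diag M i) (natr_bin_diag M j); field.
Qed.

(** With [N = M + 1], the increment rests on [(N - i)(N - j)p(i, j) - ij p(i - 1, j - 1) = M(N -
    2i)(N - i - j)(N - 2j)]; keeping [M] on the left avoids dividing by it. *)
Lemma sum_bin_cubic (M a b : nat) : (a <= b)%N ->
  M%:R * \sum_(0 <= k < a.+1)
     (M.+1%:R - (b - k)%:R *+ 2) * (M.+1%:R - (a - k)%:R - (b - k)%:R)
       * (M.+1%:R - (a - k)%:R *+ 2)
       * 'C(M.+1, a - k)%:R * 'C(M.+1, b - k)%:R
  = M.+1%:R ^+ 2 * ((M%:R - a%:R *+ 2) * (M%:R - b%:R *+ 2) + M%:R)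
      * 'C(M, a)%:R * 'C(M, b)%:R :> F.
Proof.
have M0 : 1 + M%:R != 0 :> F by rewrite -mulrS Num.Theory.pnatr_eq0.
rewrite big_distrr /=.
pose t i j : F :=
  M%:R * ((M.+1%:R - j%:R *+ 2) * (M.+1%:R - i%:R - j%:R)
    * (M.+1%:R - i%:R *+ 2) * 'C(M.+1, i)%:R * 'C(M.+1, j)%:R).
pose G i j : F :=
  M.+1%:R ^+ 2 * ((M%:R - i%:R *+ 2) * (M%:R - j%:R *+ 2) + M%:R)
    * 'C(M, i)%:R * 'C(M, j)%:R.
apply: (@sum_diag_telescope _ t G) => [j|i j]; rewrite /t /G.
  by rewrite !bin0 (natr_bin_down M j); field.
rewrite (natr_bin_down M i.+1) (natr_bin_down M j.+1).
by rewrite (natr_bin_diag M i) (natr_bin_diag M j); field.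
Qed.

End Telescoping.

Local Ltac field_pos :=
  field; rewrite !Num.Theory.lt0r_neq0 //; lra.

Lemma bin_central_odd (n : nat) :
  'C(2 * n + 2, n + 1)%:R = 2%:R * 'C(2 * n + 1, n)%:R :> rat.
Proof.
have -> : (2 * n + 2 = (2 * n + 1).+1)%N by lia.
have n0 : 0 <= n%:R :> rat by rewrite Num.Theory.ler0n.
rewrite (natr_bin_diag rat (2 * n + 1) n) -(addn1 n).
by field_pos.
Qed.

Theorem corollary3p9 (n l : nat) (hln : (l <= n)%N) :
  [/\ (n + 1)%N%:R^-1 * 'C(2 * n + 2, n - l)%:R * catalan n =
        \sum_(0 <= k < (n - l).+1)
          ((2 * k + 1)%N%:R * (2 * k + l + 2)%N%:R * (2 * k + 2 * l + 3)%N%:R)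
          / ((2 * n + 1)%N%:R * (2 * n + 2)%N%:R * (2 * n + 3)%N%:R ^+ 2)
          * 'C(2 * n + 3, n - k - l)%:R * 'C(2 * n + 3, n - k + 1)%:R :> rat,
      (n + 1)%N%:R^-1 * 'C(2 * n + 2, n - l)%:R * catalan (n + 1) =
        \sum_(0 <= k < (n - l).+1)
          ((2 * k + 2)%N%:R * (2 * k + l + 3)%N%:R * (2 * k + 2 * l + 4)%N%:R)
          / ((2 * n + 2)%N%:R * (2 * n + 3)%N%:R * (2 * n + 4)%N%:R ^+ 2)
          * 'C(2 * n + 4, n - k - l)%:R * 'C(2 * n + 4, n - k + 1)%:R :> rat
    & (n + 1)%N%:R^-1 * 'C(2 * n + 2, n - l)%:R * 'C(2 * n + 1, n)%:R =
        \sum_(0 <= k < (n - l).+1)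
          (2 * k + l + 2)%N%:R / ((2 * n + 2)%N%:R * (2 * n + 3)%N%:R)
          * 'C(2 * n + 3, n - k - l)%:R * 'C(2 * n + 3, n - k + 1)%:R :> rat].
Proof.
have n0 : 0 <= n%:R :> rat by rewrite Num.Theory.ler0n.
(* In this range no natural subtraction truncates, and the lower indices take the form [a - k],
   [b - k] with [a = n - l], [b = n + 1]. *)
have e k : (k < (n - l).+1)%N ->
    [/\ (n - k - l = n - l - k)%N, (n - k + 1 = n + 1 - k)%N,
      (n - l - k)%:R = n%:R - l%:R - k%:R :> rat
      & (n + 1 - k)%:R = n%:R + 1 - k%:R :> rat].
  move=> hk; split; try lia.
    by rewrite !natrB //; lia.
  by rewrite natrB ?natrD //; lia.
have ea : (n - l)%:R = n%:R - l%:R :> rat by rewrite natrB.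
have hab : (n - l <= n + 1)%N by lia.
rewrite /catalan; split.
- have := sum_bin_cubic rat (2 * n + 2) _ _ hab.
  have -> : ((2 * n + 2).+1 = 2 * n + 3)%N by lia.
  set S := \sum_(0 <= k < _) _ => ES.
  transitivity
    (S / ((2 * n + 1)%N%:R * (2 * n + 2)%N%:R * (2 * n + 3)%N%:R ^+ 2)); last first.
    rewrite /S big_distrl; apply: eq_big_nat => k /e[-> -> e1 e2].
    by rewrite /= e1 e2; field_pos.
  (* Here [M - 2b = 0], so [p(a, b) = M = 2n + 2] cancels the factor in front of the sum. *)
  have -> : S = (2 * n + 3)%N%:R ^+ 2
      * 'C(2 * n + 2, n - l)%:R * 'C(2 * n + 2, n + 1)%:R.
    apply: (@mulfI _ (2 * n + 2)%N%:R); first by rewrite Num.Theory.pnatr_eq0 addn2.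
    by rewrite ES ea; ring.
  rewrite bin_central_odd (natr_bin_down rat (2 * n)) -(addn1 (2 * n)).
  by field_pos.
- have := sum_bin_cubic rat (2 * n + 3) _ _ hab.
  have -> : ((2 * n + 3).+1 = 2 * n + 4)%N by lia.
  set S := \sum_(0 <= k < _) _ => ES.
  transitivity
    (S / ((2 * n + 2)%N%:R * (2 * n + 3)%N%:R * (2 * n + 4)%N%:R ^+ 2)); last first.
    rewrite /S big_distrl; apply: eq_big_nat => k /e[-> -> e1 e2].
    by rewrite /= e1 e2; field_pos.
  (* Here [M - 2a = 2l + 3] and [M - 2b = 1], so [p(a, b) = (2l + 3) + (2n + 3) = 2(n + l + 3)]. *)
  have -> : S = (2 * n + 4)%N%:R ^+ 2 * (2 * (n + l + 3))%N%:R / (2 * n + 3)%N%:R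
      * 'C(2 * n + 3, n - l)%:R * 'C(2 * n + 3, n + 1)%:R.
    apply: (@mulfI _ (2 * n + 3)%N%:R); first by rewrite Num.Theory.pnatr_eq0 addn3.
    by rewrite ES ea; field_pos.
  have -> : (2 * (n + 1) = 2 * n + 2)%N by lia.
  (* Lifting both binomials to row [2n + 3] produces the factors [n + l + 3], matching [p(a, b)],
     and [n + 2], cancelling the Catalan denominator. *)
  rewrite !(natr_bin_down rat (2 * n + 2)).
  have -> : ((2 * n + 2).+1 = 2 * n + 3)%N by lia.
  by rewrite ea; field_pos.
- have := sum_bin_linear rat (2 * n + 2) _ _ hab.
  have -> : ((2 * n + 2).+1 = 2 * n + 3)%N by lia.
  set S := \sum_(0 <= k < _) _ => ES.
  transitivity (S / ((2 * n + 2)%N%:R * (2 * n + 3)%N%:R)); last first.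
    rewrite /S big_distrl; apply: eq_big_nat => k /e[-> -> e1 e2].
    by rewrite /= e1 e2; field_pos.
  rewrite ES bin_central_odd; field_pos.
Qed.
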